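(* Let $m\ge 2$ and consider testing $H_0: A\sim\mathcal{H}_m(N,p_0)$ against $H_1: A\sim\mathcal{H}_m(N,p_0;n,p_1)$ with $p_1=1$ and known $0<p_0<1$. The following results hold. (I) All tests are asymptotically powerless if for a constant $\epsilon\in(0,1)$, $$n\le \left[m!(1-\epsilon)\log_{\frac{1}{p_0}}N\right]^{\frac{1}{m-1}}.$$ (II) The hypergraphic clique number test (HCNT) is asymptotically powerful if for a constant $\epsilon\in(0,1)$, $$n\ge \left[m!(1+\epsilon)\log_{\frac{1}{p_0}}N\right]^{\frac{1}{m-1}}.$$
   Context: An undirected $m$-uniform hypergraph on $[N]=\{1,\dots,N\}$ is encoded by its symmetric 0-1 adjacency tensor $A$: $A_{i_1\ldots i_m}=1$ iff $\{i_1,\ldots,i_m\}$ is an edge (each edge consists of exactly $m$ vertices). $A\sim\mathcal{H}_m(N,p_0)$ means that the $A_{i_1\ldots i_m}$, $1\le i_1<\cdots<i_m\le N$, are i.i.d. Bernoulli with success probability $p_0$; write $\mathbb{P}_0$ for this law. $A\sim\mathcal{H}_m(N,p_0;n,p_1)$ means that there is a subset $S\subset[N]$ with $|S|=n$ such that the $A_{i_1\ldots i_m}$, $i_1<\cdots<i_m$, are independent Bernoulli with success probability $p_1$ if $i_1,\ldots,i_m$ all belong to $S$ and $p_0$ otherwise; write $\mathbb{P}_S$ for this law. A test $T$ is a 0-1 valued function of $A$, with $T=1$ iff $H_0$ is rejected; its risk is $\gamma_N(T)=\mathbb{P}_0(T=1)+\max_{|S|=n}\mathbb{P}_S(T=0)$.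 A test $T$ is asymptotically powerful if $\gamma_N(T)\to0$ and asymptotically powerless if $\gamma_N(T)\to1$. HCNT is the test based on the clique number $\omega_N=\max\{0\le k\le N:\ \text{there is } V\subset[N] \text{ with } |V|=k \text{ and } W_V=\binom{k}{m}\}$, where $W_V=\sum_{i_1<\cdots<i_m,\ i_1,\ldots,i_m\in V}A_{i_1\ldots i_m}$ is the number of edges in the subhypergraph restricted to $V$.
   Formalization: In (I), ''all tests are powerless'' is read as: every test has liminf risk ≥ 1, and risk → 1 if its risk is eventually ≤ 1; literally, rejecting unless a fixed n-set is a clique has risk → 2 when n → ∞. HCNT rejects iff the clique number is ≥ n. *)

(* Defs.v *)
From HB Require Import structures.
From mathcomp Require Import all_boot all_order all_algebra.
From mathcomp Require Import all_classical all_reals all_analysis.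

Set Implicit Arguments.
Unset Strict Implicit.
Unset Printing Implicit Defensive.

Import Order.TTheory GRing.Theory Num.Theory.
Import numFieldNormedType.Exports.

Local Open Scope classical_set_scope.
Local Open Scope ring_scope.

(* The vertex set [N] is 'I_N. A potential edge is a set of exactly m vertices,
   i.e. the index set of a coordinate A_{i_1 ... i_m} with i_1 < ... < i_m; the
   other entries of the symmetric tensor are determined by these. *)
Definition hyperedge (m N : nat) : Type := {e : {set 'I_N} | #|e| == m}.

Definition hypergraph (m N : nat) : Type := {ffun hyperedge m N -> bool}.

(* Joint law of independent Bernoulli coordinates with parameters q e. *)
Definition bernoulli_prob (R : realType) (m N : nat) (q : hyperedge m N -> R)
    (E : pred (hypergraph m N)) : R :=
  \sum_(A : hypergraph m N | E A)
    \prod_(e : hyperedge m N) bernoulli_pmf (q e) (A e).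

(* P_0, the law H_m(N, p0). *)
Definition P0 (R : realType) (m N : nat) (p0 : R) :
    pred (hypergraph m N) -> R :=
  bernoulli_prob (fun _ => p0).

(* P_S, the law H_m(N, p0; n, p1) with planted set S, n = #|S|. *)
Definition PS (R : realType) (m N : nat) (p0 p1 : R) (S : {set 'I_N}) :
    pred (hypergraph m N) -> R :=
  bernoulli_prob (fun e => if val e \subset S then p1 else p0).

(* true means that H_0 is rejected. *)
Definition test (m N : nat) : Type := hypergraph m N -> bool.

(* The default value 0 of the maximum is harmless: the probabilities are
   nonnegative, and sets S with #|S| = n exist as soon as n <= N. *)
Definition risk (R : realType) (m N n : nat) (p0 p1 : R) (T : test m N) : R :=
  P0 p0 [pred A | T A] +
  \big[Num.max/0]_(S : {set 'I_N} | #|S| == n) PS p0 p1 S [pred A | ~~ T A].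

Definition asymptotically_powerful (R : realType) (m : nat) (n : nat -> nat)
    (p0 p1 : R) (T : forall N, test m N) : Prop :=
  risk (n N) p0 p1 (T N) @[N --> \oo] --> (0 : R).

Definition asymptotically_powerless (R : realType) (m : nat) (n : nat -> nat)
    (p0 p1 : R) (T : forall N, test m N) : Prop :=
  risk (n N) p0 p1 (T N) @[N --> \oo] --> (1 : R).

(* Never rejecting has risk 1, but a test can be worse than that: rejecting
   unless a fixed n-set is a clique has risk tending to 2 when p1 = 1 and the
   number 'C(n, m) of its possible edges tends to infinity. "All tests are powerless" thus
   means that no test has risk asymptotically below 1, so that the risk of any
   test which is not worse than the trivial one tends to 1. *)
Definition all_tests_asymptotically_powerless (R : realType) (m : nat)
    (n : nat -> nat) (p0 p1 : R) : Prop :=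
  forall T : forall N, test m N,
    (forall delta : R, 0 < delta ->
       \forall N \near \oo, 1 - delta <= risk (n N) p0 p1 (T N)) /\
    ((\forall N \near \oo, risk (n N) p0 p1 (T N) <= 1) ->
       asymptotically_powerless n p0 p1 T).

(* W_V, the number of edges inside V. *)
Definition edges_within (m N : nat) (A : hypergraph m N) (V : {set 'I_N}) :
    nat :=
  (\sum_(e : hyperedge m N | val e \subset V) A e)%N.

Definition clique_number (m N : nat) (A : hypergraph m N) : nat :=
  (\max_(k < N.+1 |
     [exists V : {set 'I_N}, (#|V| == k) && (edges_within A V == 'C(k, m))])
     k)%N.

(* The critical value is the size n of the planted clique. *)
Definition HCNT (m : nat) (n : nat -> nat) (N : nat) : test m N :=
  fun A => (n N <= clique_number A)%N.

(* [m! c log_{1/p0} N]^{1/(m-1)} *)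
Definition clique_threshold (R : realType) (m : nat) (p0 c : R) (N : nat) : R :=
  (m`!%:R * c * (ln N%:R / ln p0^-1)) `^ (m.-1%:R)^-1.

(* Main.v *)
(* Lower bound: the likelihood ratio of the uniform mixture of the P_S is X / E_0 X, where
   X counts the n-cliques, and E_0 X^2 / (E_0 X)^2 is the mean of p0^(-'C(|S :&: S'|, m)) over
   independent uniform n-sets S, S'. Below the threshold this quantity is at most
   a^|S :&: S'| with a = N^(1 - eps). Expanding a^|S :&: S'| as the sum of (a - 1)^|W| over
   W contained in S :&: S', and using P(W \subset S') <= (n / N)^|W|, bounds its mean by
   (1 + (a - 1) n / N)^n <= exp (n^2 N^(-eps)), which tends to 1 as n is polylogarithmic.
   Upper bound: a planted clique is always detected, and the false alarms are controlled by the
   first moment E_0 X = 'C(N, n) p0^'C(n, m). *)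
Require Import Defs.
From HB Require Import structures.
From mathcomp Require Import all_boot all_order all_algebra.
From mathcomp Require Import all_classical all_reals all_analysis.
From mathcomp Require Import ring lra zify.

Set Implicit Arguments.
Unset Strict Implicit.
Unset Printing Implicit Defensive.

Import Order.TTheory GRing.Theory Num.Theory.
Import numFieldNormedType.Exports.

Local Open Scope classical_set_scope.
Local Open Scope ring_scope.

(** * Cliques and the clique number *)

Definition clique (m N : nat) (A : hypergraph m N) (V : {set 'I_N}) : bool :=
  [forall (e : hyperedge m N | val e \subset V), A e].

Lemma card_hyperedges_within (m N : nat) (V : {set 'I_N}) :
  #|[pred e : hyperedge m N | val e \subset V]| = 'C(#|V|, m).
Proof.
rewrite -cards_draws -[LHS](card_imset _ val_inj).
congr #|pred_of_set _|; apply/setP => B; rewrite !inE; apply/imsetP/andP => [[e] | [BV Bm]].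
  by rewrite !inE => eV ->; split=> //; exact: (valP e).
by exists (Sub B Bm); rewrite ?inE SubK.
Qed.

(** The edge count is a sum of ['C(#|V|, m)] terms, each at most 1, so it attains this value only if
    every term is 1. *)
Lemma cliqueE (m N : nat) (A : hypergraph m N) (V : {set 'I_N}) :
  clique A V = (edges_within A V == 'C(#|V|, m)).
Proof.
rewrite -card_hyperedges_within -sum1_card /edges_within.
have := @leqif_sum _ (fun e : hyperedge m N => val e \subset V)
  (fun e => A e) (fun e => A e : nat) (fun=> 1%N).
case=> [e _|_ E]; first by case: (A e).
by rewrite [RHS]E.
Qed.

Lemma cliqueS (m N : nat) (A : hypergraph m N) (V W : {set 'I_N}) :
  V \subset W -> clique A W -> clique A V.
Proof.
move=> VW /forall_inP AW; apply/forall_inP => e eV.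
by apply: AW; exact: fintype.subset_trans VW.
Qed.

Lemma leq_clique_number (m N : nat) (A : hypergraph m N) (V : {set 'I_N}) :
  clique A V -> (#|V| <= clique_number A)%N.
Proof.
rewrite cliqueE => AV.
have VN : (#|V| < N.+1)%N by rewrite ltnS -[leqRHS]card_ord max_card.
apply: (@leq_bigmax_cond _ _ _ (Ordinal VN)).
by apply/existsP; exists V; rewrite eqxx.
Qed.

(** The maximum is attained by a clique on at least [k] vertices, and any [k] of these still form a
    clique. *)
Lemma clique_number_geq (m N : nat) (A : hypergraph m N) (k : nat) :
  (0 < k)%N -> (k <= clique_number A)%N ->
  exists2 V : {set 'I_N}, #|V| = k & clique A V.
Proof.
move=> k0 kA.
case: (boolP [exists (V : {set 'I_N} | #|V| == k), clique A V]).
  by case/exists_inP=> V /eqP Vk AV; exists V.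
move=> noV; suff: ~~ (k <= clique_number A)%N by rewrite kA.
rewrite -ltnNge -(prednK k0) ltnS; apply/bigmax_leqP => j /existsP[V].
case/andP=> /eqP Vj AV; rewrite -ltnS (prednK k0) ltnNge.
apply: contra noV => kj.
have: (0 < #|[set W : {set 'I_N} | W \subset V & #|W| == k]|)%N.
  by rewrite cards_draws bin_gt0 Vj.
case/card_gt0P=> W; rewrite inE => /andP[WV /eqP Wk].
apply/exists_inP; exists W; first exact/eqP.
by apply: (cliqueS WV); rewrite cliqueE Vj.
Qed.

(** * Counting [n]-sets and their overlaps *)

Lemma card_supersets (N n : nat) (V : {set 'I_N}) : (#|V| <= n)%N ->
  #|[set S : {set 'I_N} | V \subset S & #|S| == n]| =
  'C(N - #|V|, n - #|V|).
Proof.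
move=> Vn; have <- : #|~: V| = (N - #|V|)%N by rewrite cardsCs finset.setCK card_ord.
rewrite -cards_draws -(card_in_imset (f := fun S => S :\: V)) => [|S S'].
  congr #|pred_of_set _|; apply/setP => W; rewrite !inE.
  apply/imsetP/andP => [[S]|[WV /eqP Wn]].
    rewrite inE => /andP[VS /eqP Sn] ->.
    by rewrite cardsDS // Sn finset.subsetDr.
  have dWV : W :&: V = finset.set0.
    by apply/eqP; rewrite finset.setI_eq0 finset.disjoints_subset.
  exists (W :|: V).
    rewrite inE finset.subsetUr cardsU dWV.
    by rewrite cards0 subn0 Wn subnK ?eqxx.
  rewrite finset.setDUl finset.setDv finset.setU0.
  by apply/esym/finset.setDidPl; rewrite -finset.setI_eq0 dWV.
rewrite !inE => /andP[VS _] /andP[VS' _] E.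
by rewrite -(finset.setID S V) -(finset.setID S' V) E !(finset.setIidPr _).
Qed.

(** The ratio of ['C(N - t, n - t)] to ['C(N, n)], the probability that a uniform [n]-set contains
    [t] given points, is a product of factors [(n - i) / (N - i)] with [i < t], each at most
    [n / N]. *)
Lemma bin_sub_ratio (N n t : nat) : (n <= N)%N -> (t <= n)%N ->
  ('C(N - t, n - t) * N ^ t <= 'C(N, n) * n ^ t)%N.
Proof.
move=> nN; elim: t => [|t IH] tn; first by rewrite !subn0.
have Nt : (0 < N - t)%N by rewrite subn_gt0 (leq_trans tn).
rewrite -(leq_pmul2l Nt).
have diag : ((N - t) * 'C(N - t.+1, n - t.+1) = (n - t) * 'C(N - t, n - t))%N.
  by rewrite !subnS mul_bin_diag prednK // subn_gt0.
rewrite mulnA diag !expnS.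
have -> : ((n - t) * 'C(N - t, n - t) * (N * N ^ t) =
           ((n - t) * N) * ('C(N - t, n - t) * N ^ t))%N by lia.
have -> : ((N - t) * ('C(N, n) * (n * n ^ t)) =
           ((N - t) * n) * ('C(N, n) * n ^ t))%N by lia.
apply: leq_mul; last exact/IH/ltnW.
by rewrite !mulnBl (mulnC N n) leq_sub2l // leq_mul2l nN orbT.
Qed.

Lemma sum_subset_expr (R : comNzRingType) (N : nat) (b : R) (V : {set 'I_N}) :
  \sum_(W : {set 'I_N} | W \subset V) b ^+ #|W| = (1 + b) ^+ #|V|.
Proof.
rewrite -prodr_const [RHS]big_mkcond /=.
(* Outside [V] the factor becomes [0 + 1], so expanding the product over all of ['I_N] gives 0 for
   each [W] not contained in [V]. *)
rewrite (eq_bigr (fun i : 'I_N => (if i \in V then b else 0) + 1)); last first.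
  by move=> i _; case: ifP => _; rewrite ?add0r // addrC.
rewrite bigA_distr big_mkcond; apply: eq_bigr => W _.
case: ifPn => [/fintype.subsetP WV|].
  by rewrite -prodr_const big_mkcond; apply: eq_bigr => i _; case: ifP => // /WV ->.
case/fintype.subsetPn => i iW /negbTE iV.
by rewrite (bigD1 i) //= iW iV mul0r.
Qed.

Lemma sum_expr_cardI (R : realFieldType) (N n : nat) (a : R) (V : {set 'I_N}) :
  (n <= N)%N -> #|V| = n -> 1 <= a ->
  \sum_(S : {set 'I_N} | #|S| == n) a ^+ #|V :&: S| <=
  'C(N, n)%:R * (1 + (a - 1) * (n%:R / N%:R)) ^+ n.
Proof.
move=> nN Vn a1; have b0 : 0 <= a - 1 by rewrite subr_ge0.
have aE : a = 1 + (a - 1) by rewrite addrC subrK.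
rewrite -[X in _ * _ ^+ X]Vn -sum_subset_expr mulr_sumr.
rewrite [in leLHS]aE; under eq_bigr do rewrite -sum_subset_expr.
(* With [W] outermost, the inner sum counts the [n]-sets containing [W]. As [1 <= a], the weights
   [(a - 1) ^+ #|W|] are nonnegative and the bound may be taken term by term. *)
rewrite (exchange_big_dep (fun W : {set 'I_N} => W \subset V)) /=; last first.
  by move=> S W _; rewrite finset.subsetI => /andP[].
apply: ler_sum => W WV.
rewrite (eq_bigl (fun S : {set 'I_N} =>
  S \in [set S : {set 'I_N} | W \subset S & #|S| == n])); last first.
  by move=> S; rewrite inE finset.subsetI WV andbC.
have Wn : (#|W| <= n)%N by rewrite -Vn subset_leq_card.
rewrite sumr_const card_supersets // exprMn -(mulr_natr (_ ^+ _)) [leRHS]mulrCA.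
apply: ler_wpM2l; first exact: exprn_ge0.
(* The bound divides by a power of [N]; for [N = 0] only the empty [W] remains and both sides
   agree. *)
rewrite expr_div_n; case: (posnP N) => [N0|N0].
  have n0 : n = 0%N by apply/eqP; rewrite -leqn0 -N0.
  by move: Wn; rewrite n0 leqn0 => /eqP ->; rewrite !subn0 !expr0 divr1 mulr1.
rewrite mulrA ler_pdivlMr ?exprn_gt0 ?ltr0n // -!natrX -!natrM ler_nat.
exact: bin_sub_ratio.
Qed.

(** * Moments of the clique count and a lower bound on the risk *)

Section planted_clique.
Context {R : realType} {m N : nat}.
Implicit Types (p : R) (A : hypergraph m N) (S V : {set 'I_N}).

Definition P0_mass p A : R := \prod_(e : hyperedge m N) bernoulli_pmf p (A e).

Lemma P0_mass_ge0 p A : 0 <= p <= 1 -> 0 <= P0_mass p A.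
Proof. by move=> p01; apply: prodr_ge0 => e _; exact: bernoulli_pmf_ge0. Qed.

(** The indicator of the event factors over the edges, so the sum over [A] becomes a product of
    one-edge sums: [p] for an edge in [D], and [p + (1 - p) = 1] for any other. *)
Lemma P0_all_edges p (D : pred (hyperedge m N)) :
  P0 p [pred A : hypergraph m N | [forall (e | D e), A e]] = p ^+ #|D|.
Proof.
rewrite /P0 /Defs.bernoulli_prob big_mkcond /=.
transitivity (\sum_(A : hypergraph m N)
    \prod_(e : hyperedge m N) (bernoulli_pmf p (A e) * (D e ==> A e)%:R)).
  apply: eq_bigr => A _; case: ifPn => [/forall_inP AD|].
    by apply: eq_bigr => e _; rewrite (introT implyP (AD e)) mulr1.
  rewrite negb_forall => /existsP[e /negbTE De].
  by rewrite (bigD1 e) //= De mulr0 mul0r.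
rewrite -(bigA_distr_bigA
  (fun (e : hyperedge m N) b => bernoulli_pmf p b * (D e ==> b)%:R)).
rewrite -prodr_const [RHS]big_mkcond; apply: eq_bigr => e _.
rewrite big_bool /= implybT implybF mulr1 unfold_in.
by case: (D e); rewrite /= ?mulr0 ?addr0 // mulr1 addrC subrK.
Qed.

Lemma P0_clique p V :
  P0 p [pred A : hypergraph m N | clique A V] = p ^+ 'C(#|V|, m).
Proof. by rewrite -card_hyperedges_within -P0_all_edges. Qed.

Lemma P0_mass_sum1 p : \sum_A P0_mass p A = 1.
Proof.
rewrite -[RHS](expr0 p) -[in RHS](card0 (hyperedge m N)) -P0_all_edges.
by apply: eq_bigl => A; apply/esym/forall_inP.
Qed.

(** Planting with probability 1 amounts to conditioning [P0] on [S] being a clique: the likelihood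
    ratio is the clique indicator divided by its mean. *)
Lemma PS1E p S (E : pred (hypergraph m N)) : p != 0 ->
  PS p 1 S E =
  (p ^+ 'C(#|S|, m))^-1 * P0 p [pred A | clique A S && E A].
Proof.
move=> p0; rewrite /PS /P0 /Defs.bernoulli_prob mulr_sumr.
rewrite big_mkcond [RHS]big_mkcond; apply: eq_bigr => A _ /=.
case: (E A); rewrite ?andbF // andbT; case: ifPn => [/forall_inP AS|].
  rewrite -card_hyperedges_within -prodr_const -prodfV [X in _ = X * _]big_mkcond.
  rewrite -big_split.
  apply: eq_bigr => e _ /=; rewrite unfold_in /=; case: ifP => eS.
    by rewrite AS // mulVf.
  by rewrite mul1r.
rewrite negb_forall => /existsP[e]; rewrite negb_imply => /andP[eS /negbTE Ae].
by rewrite (bigD1 e) //= eS Ae /= subrr mul0r.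
Qed.

(** Inclusion-exclusion on the required edges: those lying in both [S] and [V] are exactly those
    lying in [S :&: V]. *)
Lemma P0_two_cliques p S V : p != 0 ->
  P0 p [pred A : hypergraph m N | clique A S && clique A V] =
  p ^+ 'C(#|S|, m) * p ^+ 'C(#|V|, m) / p ^+ 'C(#|S :&: V|, m).
Proof.
move=> p0.
rewrite -!card_hyperedges_within -exprD -cardUI exprD.
have <- : #|[predI [pred e : hyperedge m N | val e \subset S]
                 & [pred e : hyperedge m N | val e \subset V]]| =
          #|[pred e : hyperedge m N | val e \subset S :&: V]|.
  by apply: eq_card => e; rewrite !inE finset.subsetI.
rewrite mulfK ?expf_neq0 // -P0_all_edges.
apply: eq_bigl => A; apply/andP/forall_inP => [[/forall_inP AS /forall_inP AV] e|AD].
  by rewrite !inE => /orP[]; [exact: AS|exact: AV].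
by split; apply/forall_inP => e eS; apply: AD; rewrite !inE /= eS ?orbT.
Qed.

Definition clique_count (n : nat) A : R :=
  \sum_(S : {set 'I_N} | #|S| == n) (clique A S)%:R.

Lemma clique_count_mean p n :
  \sum_A P0_mass p A * clique_count n A = 'C(N, n)%:R * p ^+ 'C(n, m).
Proof.
under eq_bigr do rewrite mulr_sumr.
rewrite exchange_big /=.
rewrite (eq_bigr (fun=> p ^+ 'C(n, m))) => [|S /eqP Sn].
  by rewrite sumr_const -cardsE card_draws card_ord mulr_natl.
rewrite -Sn -P0_clique /P0 /Defs.bernoulli_prob [RHS]big_mkcond.
by apply: eq_bigr => A _ /=; case: (clique A S); rewrite ?mulr1 ?mulr0.
Qed.

(** The square expands over pairs of [n]-sets. The hypothesis on [a] replaces the overlap factor of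
    each pair by [a ^+ #|S :&: V|], which [sum_expr_cardI] sums over [V] for each fixed [S]. *)
Lemma clique_count_second_moment p a n :
  0 < p -> (n <= N)%N -> 1 <= a ->
  (forall k, (k <= n)%N -> (p ^+ 'C(k, m))^-1 <= a ^+ k) ->
  \sum_A P0_mass p A * clique_count n A ^+ 2 <=
  ('C(N, n)%:R * p ^+ 'C(n, m)) ^+ 2 * (1 + (a - 1) * (n%:R / N%:R)) ^+ n.
Proof.
move=> p0 nN a1 pa; have pn0 : p != 0 by rewrite gt_eqF.
have pk0 k : 0 <= p ^+ k by rewrite exprn_ge0 // ltW.
have term S V : #|S| = n -> #|V| = n ->
    \sum_A P0_mass p A * ((clique A S)%:R * (clique A V)%:R) <=
    (p ^+ 'C(n, m)) ^+ 2 * a ^+ #|S :&: V|.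
  move=> Sn Vn; apply: (@le_trans _ _
      (P0 p [pred A : hypergraph m N | clique A S && clique A V])).
    rewrite /P0 /Defs.bernoulli_prob [leRHS]big_mkcond; apply: ler_sum => A _ /=.
    by case: (clique A S); case: (clique A V); rewrite ?mulr1 ?mulr0.
  rewrite P0_two_cliques // Sn Vn -expr2.
  apply: ler_wpM2l; first exact: exprn_ge0.
  by apply: pa; rewrite -Sn subset_leq_card // finset.subsetIl.
under eq_bigr do rewrite expr2 big_distrlr mulr_sumr /=.
under eq_bigr do under eq_bigr do rewrite mulr_sumr.
rewrite exchange_big /=; under eq_bigr do rewrite exchange_big /=.
apply: (@le_trans _ _ (\sum_(S : {set 'I_N} | #|S| == n)
    \sum_(V : {set 'I_N} | #|V| == n) (p ^+ 'C(n, m)) ^+ 2 * a ^+ #|S :&: V|)).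
  by apply: ler_sum => S /eqP Sn; apply: ler_sum => V /eqP Vn; exact: term.
apply: (@le_trans _ _ (\sum_(S : {set 'I_N} | #|S| == n)
    (p ^+ 'C(n, m)) ^+ 2 *
    ('C(N, n)%:R * (1 + (a - 1) * (n%:R / N%:R)) ^+ n))).
  apply: ler_sum => S /eqP Sn; rewrite -mulr_sumr; apply: ler_wpM2l; first exact: exprn_ge0.
  exact: sum_expr_cardI.
rewrite sumr_const -cardsE card_draws card_ord -mulr_natl.
by rewrite le_eqVlt; apply/orP; left; apply/eqP; ring.
Qed.

(** With [y] the clique count divided by its mean, the risk is at least 1 minus the [P0]-mean of
    [1 - y] over the acceptance region. As [y] has mean 1 and variance at most [delta ^+ 2], that
    loss is at most [delta]. *)
Lemma risk_ge p n (delta : R) (T : test m N) :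
  0 < p -> p <= 1 -> (n <= N)%N -> 0 < delta ->
  \sum_A P0_mass p A * clique_count n A ^+ 2 <=
    ('C(N, n)%:R * p ^+ 'C(n, m)) ^+ 2 * (1 + delta ^+ 2) ->
  1 - delta <= risk n p 1 T.
Proof.
move=> p0 p1 nN d0; set M := _%:R * _ => second.
have pn0 : p != 0 by rewrite gt_eqF.
have M0 : 0 < M by apply: mulr_gt0; rewrite ?exprn_gt0 // ltr0n bin_gt0.
have mass0 A : 0 <= P0_mass p A by apply: P0_mass_ge0; rewrite ltW.
pose y A := clique_count n A / M.
have mean_y : \sum_A P0_mass p A * y A = 1.
  under eq_bigr do rewrite mulrA.
  by rewrite -mulr_suml clique_count_mean divff ?gt_eqF.
have second_y : \sum_A P0_mass p A * y A ^+ 2 <= 1 + delta ^+ 2.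
  under eq_bigr do rewrite exprMn mulrA.
  by rewrite -mulr_suml exprVn ler_pdivrMr ?exprn_gt0 // mulrC.
rewrite /risk; set mx := \big[_/_]_(_ | _) _.
(* The maximum over [S] dominates the average over [S], and by [PS1E] the averaged law has density
   [y] with respect to [P0]. *)
have mx_ge : \sum_(A | ~~ T A) P0_mass p A * y A <= mx.
  have : \sum_(S : {set 'I_N} | #|S| == n) PS p 1 S [pred A | ~~ T A] <=
         'C(N, n)%:R * mx.
    apply: (@le_trans _ _ (\sum_(S : {set 'I_N} | #|S| == n) mx)).
      by apply: ler_sum => S Sn; exact: le_bigmax_cond.
    by rewrite sumr_const -cardsE card_draws card_ord mulr_natl.
  rewrite mulrC -ler_pdivrMr ?ltr0n ?bin_gt0 //; apply: le_trans.
  rewrite le_eqVlt; apply/orP; left; apply/eqP.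
  rewrite (eq_bigr (fun S : {set 'I_N} => (p ^+ 'C(n, m))^-1 *
      \sum_(A | ~~ T A) P0_mass p A * (clique A S)%:R)) => [|S /eqP Sn].
    rewrite -mulr_sumr exchange_big /= mulrC mulr_sumr mulr_sumr.
    apply: eq_bigr => A _; rewrite -mulr_sumr /y /M invfM.
    by rewrite -/(clique_count n A); ring.
  rewrite PS1E // Sn /P0 /Defs.bernoulli_prob; congr (_ * _).
  rewrite big_mkcond [RHS]big_mkcond; apply: eq_bigr => A _ /=.
  by case: (T A); case: (clique A S); rewrite ?mulr1 ?mulr0.
have P0T : P0 p [pred A | T A] = 1 - \sum_(A | ~~ T A) P0_mass p A.
  by rewrite -(P0_mass_sum1 p) (bigID T) /= addrK.
rewrite P0T.
suff : \sum_(A | ~~ T A) P0_mass p A * (1 - y A) <= delta.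
  under eq_bigr do rewrite mulrBr mulr1.
  by rewrite sumrB; move: mx_ge; lra.
(* AM-GM on [1 - y], in place of the Cauchy-Schwarz inequality *)
pose u := delta / 2 + (2 * delta)^-1; pose v := - delta^-1; pose w := (2 * delta)^-1.
have w0 : 0 < w by rewrite invr_gt0; lra.
have amgm x : 1 - x <= u + v * x + w * x ^+ 2.
  rewrite -subr_ge0.
  have -> : u + v * x + w * x ^+ 2 - (1 - x) = w * (1 - x - delta) ^+ 2.
    by rewrite /u /v /w; field; rewrite gt_eqF.
  by rewrite mulr_ge0 ?sqr_ge0 // ltW.
(* The quadratic equals [delta / 2 + (1 - y A) ^+ 2 / (2 * delta)]. It is nonnegative, so the sum
   extends to all [A], where its mean is at most [delta / 2 + delta / 2]. *)
apply: (@le_trans _ _ (\sum_A P0_mass p A * (u + v * y A + w * y A ^+ 2))).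
  rewrite [leRHS](bigID (fun A => ~~ T A)) /= -[leLHS]addr0; apply: lerD.
    by apply: ler_sum => A _; exact: ler_wpM2l.
  apply: sumr_ge0 => A _; rewrite mulr_ge0 //.
  have -> : u + v * y A + w * y A ^+ 2 =
      delta / 2 + w * (1 - y A) ^+ 2.
    by rewrite /u /v /w; field; rewrite gt_eqF.
  apply: addr_ge0; first by rewrite divr_ge0 // ltW.
  by rewrite mulr_ge0 ?sqr_ge0 // ltW.
rewrite (eq_bigr (fun A => u * P0_mass p A + v * (P0_mass p A * y A) +
    w * (P0_mass p A * y A ^+ 2))) => [|A _]; last by ring.
rewrite !big_split /= -!mulr_sumr P0_mass_sum1 mean_y.
apply: (@le_trans _ _ (u * 1 + v * 1 + w * (1 + delta ^+ 2))).
  by rewrite lerD2l ler_pM2l.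
rewrite le_eqVlt; apply/orP; left; apply/eqP.
by rewrite /u /v /w; field; rewrite gt_eqF.
Qed.

End planted_clique.

(** * Risk of the clique number test *)

Lemma risk_HCNT_le (R : realType) (m N : nat) (p : R) (n : nat -> nat) :
  0 < p -> p <= 1 -> (0 < n N)%N -> (n N <= N)%N ->
  0 <= risk (n N) p 1 (@HCNT m n N) <= 'C(N, n N)%:R * p ^+ 'C(n N, m).
Proof.
move=> p0 p1 n0 nN; have pn0 : p != 0 by rewrite gt_eqF.
have mass0 (A : hypergraph m N) : 0 <= P0_mass p A.
  by apply: P0_mass_ge0; rewrite ltW.
have -> : risk (n N) p 1 (@HCNT m n N) = P0 p [pred A | @HCNT m n N A].
  (* The planted clique is always detected, so every term of the maximum is 0, as is its default
     value. *)
  rewrite -[RHS]addr0; congr (_ + _); apply: big1_idem => [|S /eqP Sn].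
    exact: maxxx.
  rewrite PS1E // [P0 _ _]big1 ?mulr0 // => A /andP[AS /negP[]].
  by rewrite /HCNT -Sn; exact: leq_clique_number.
apply/andP; split; first by apply: sumr_ge0 => A _; exact: mass0.
rewrite -clique_count_mean /P0 /Defs.bernoulli_prob big_mkcond /=.
apply: ler_sum => A _; case: ifPn => [/(clique_number_geq n0)[V /eqP Vn AV]|_]; last first.
  by rewrite mulr_ge0 ?mass0 // sumr_ge0.
rewrite -[leLHS]mulr1; apply: ler_wpM2l; first exact: mass0.
by rewrite /clique_count (bigD1 V) //= AV lerDl sumr_ge0.
Qed.

(** * Estimates for binomials, powers and logarithms *)

Lemma ffact_leq_expn (n m : nat) : (n ^_ m <= n ^ m)%N.
Proof.
elim: m n => [|m IH] [|n] //; rewrite ffactSS expnS leq_mul2l /=.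
by apply: (leq_trans (IH n)); case: m {IH} => // m; rewrite leq_exp2r.
Qed.

Lemma expn_leq_ffact (n m : nat) : ((n - m) ^ m <= n ^_ m)%N.
Proof.
elim: m => // m IH; rewrite expnSr ffactnSr leq_mul ?leq_sub2l //.
apply: leq_trans IH; case: m => // m; by rewrite leq_exp2r // leq_sub2l.
Qed.

Lemma bernoulli_ineq (R : realDomainType) (x : R) (k : nat) :
  0 <= x <= 1 -> 1 - x *+ k <= (1 - x) ^+ k.
Proof.
move=> /andP[x0 x1]; elim: k => [|k IH]; first by rewrite subr0.
rewrite exprS; apply: (@le_trans _ _ ((1 - x) * (1 - x *+ k))).
  have : 0 <= x * (x *+ k) by rewrite mulr_ge0 // mulrn_wge0.
  by rewrite mulrS; lra.
by apply: ler_wpM2l => //; rewrite subr_ge0.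
Qed.

Lemma clique_threshold_expr (R : realType) (m N : nat) (p c : R) :
  (2 <= m)%N -> 0 < p -> p < 1 -> 0 <= c ->
  clique_threshold m p c N ^+ m.-1 = m`!%:R * c * (ln N%:R / ln p^-1).
Proof.
move=> m2 p0 p1 c0; rewrite /clique_threshold; set X := _ * c * _.
have X0 : 0 <= X.
  apply: mulr_ge0; first exact: mulr_ge0.
  apply: divr_ge0.
    (* At [N = 0] the convention that [ln] vanishes at 0 applies. *)
    by case: N {X} => [|N]; [rewrite ln0 | rewrite ln_ge0 // ler1n].
  by rewrite ln_ge0 // invf_ge1 // ltW.
rewrite -powR_mulrn ?powR_ge0 // -powRrM mulVf ?powRr1 //.
by rewrite pnatr_eq0; case: m m2 {X X0} => [|[]].
Qed.

Lemma near_ln_ge (R : realType) (M : R) : \forall N \near \oo, M <= ln N%:R.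
Proof.
near=> N; rewrite -[M]expRK ler_ln ?posrE ?expR_gt0 //; near: N.
  exact: nbhs_infty_ger.
by apply: filterS (nbhs_infty_gt 0) => N; rewrite ltr0n.
Unshelve. all: by end_near. Qed.

Lemma near_sqr_ln_decay (R : realType) (C eps eta : R) :
  0 < eps -> 0 < eta ->
  \forall N \near \oo, (C * ln N%:R) ^+ 2 * expR (- (eps * ln N%:R)) <= eta.
Proof.
move=> eps0 eta0; near=> N.
have : 1 <= ln N%:R :> R by near: N; exact: near_ln_ge.
(* This constant comes from the bound [expR z >= z ^+ 3 / 6] at [z = eps * ln N]: a cube beats the
   square by one factor [ln N]. *)
have : C ^+ 2 * 6 / (eps ^+ 3 * eta) <= ln N%:R by near: N; exact: near_ln_ge.
set x := ln _ => xM /(lt_le_trans ltr01) x0.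
rewrite expRN ler_pdivrMr ?expR_gt0 //.
have := @expR_ge1Dxn _ (eps * x) 2; rewrite mulr_ge0 ?(ltW eps0) ?(ltW x0) //.
move=> /(_ isT) expx.
apply: (@le_trans _ _ (eta * ((eps * x) ^+ 3 / 3`!%:R))); last first.
  by rewrite ler_pM2l //; apply: le_trans expx; rewrite lerDr.
rewrite (_ : 3`! = 6)%N // mulrA ler_pdivlMr // !exprMn.
rewrite ler_pdivrMr ?mulr_gt0 ?exprn_gt0 // in xM.
rewrite (_ : _ * 6 = C ^+ 2 * 6 * x ^+ 2); last by ring.
rewrite (_ : eta * _ = x * (eps ^+ 3 * eta) * x ^+ 2); last by ring.
by rewrite ler_pM2r // exprn_gt0.
Unshelve. all: by end_near. Qed.

(** Since [k <= n], [m! 'C(k, m) <= k ^ m <= k * n ^ (m - 1)]. Keeping one factor [k] makes the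
    bound geometric in [k]. *)
Lemma inv_expr_bin_le (R : realType) (m n k : nat) (p b : R) :
  (0 < m)%N -> 0 < p -> p < 1 -> (k <= n)%N ->
  n%:R ^+ m.-1 * ln p^-1 <= m`!%:R * b ->
  (p ^+ 'C(k, m))^-1 <= expR b ^+ k.
Proof.
move=> m0 p0 p1 kn nb.
have L0 : 0 < ln p^-1 by rewrite ln_gt0 // invf_gt1.
rewrite -exprVn -[p^-1]lnK ?posrE ?invr_gt0 // -!expRM_natl ler_expR.
rewrite -(@ler_pM2l _ m`!%:R) ?ltr0n ?fact_gt0 //.
apply: (@le_trans _ _ (k%:R * (n%:R ^+ m.-1 * ln p^-1))).
  rewrite !mulrA ler_pM2r // -natrX -!natrM ler_nat mulnC bin_ffact.
  apply: (leq_trans (ffact_leq_expn _ _)).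
  rewrite -[X in (k ^ X)%N](prednK m0) expnS leq_mul2l.
  by case: m.-1 => [|j]; rewrite ?orbT // leq_exp2r // kn orbT.
by rewrite [leRHS]mulrCA; apply: ler_wpM2l.
Qed.

(** The logarithm of the mean is at most [n * x - 'C(n, m) * L]. For [n] large against
    [m ^ 2 / eps], replacing [m! 'C(n, m)] by [n ^ m] costs only a factor [1 - eps / 4], and
    [(1 - eps / 4) * (1 + eps) >= 1 + eps / 2]. *)
Lemma clique_mean_le (R : realType) (m n N : nat) (p eps : R) :
  (0 < m)%N -> (0 < N)%N -> 0 < p -> p < 1 -> 0 < eps -> eps < 1 -> (0 < n)%N ->
  (m * m)%:R * 4 <= eps * n%:R ->
  m`!%:R * (1 + eps) * ln N%:R <= n%:R ^+ m.-1 * ln p^-1 ->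
  'C(N, n)%:R * p ^+ 'C(n, m) <= expR (- (eps / 2 * ln N%:R)).
Proof.
move=> m0 N0 p0 p1 eps0 eps1 n0 mn; set x := ln N%:R; set L := ln p^-1 => nx.
have L0 : 0 < L by rewrite ln_gt0 // invf_gt1.
have x0 : 0 <= x by rewrite ln_ge0 // ler1n.
have nR0 : 0 < n%:R :> R by rewrite ltr0n.
have m1 : 1 <= m%:R :> R by rewrite ler1n.
have n1 : 1 <= n%:R :> R by rewrite ler1n.
have mmn : (m * m)%:R / n%:R <= eps / 4.
  by rewrite ler_pdivrMr // mulrAC ler_pdivlMr.
have mn01 : 0 <= (m%:R / n%:R : R) <= 1.
  rewrite divr_ge0 //= ler_pdivrMr // mul1r; move: mn; rewrite natrM.
  by have := ler_wpM2l (ler0n R m) m1; nra.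
have mlen : (m <= n)%N.
  by move: mn01 => /andP[_]; rewrite ler_pdivrMr // mul1r ler_nat.
have CN : 'C(N, n)%:R <= expR (n%:R * x).
  rewrite expRM_natl lnK ?posrE ?ltr0n // -natrX ler_nat.
  apply: leq_trans (ffact_leq_expn N n); rewrite -bin_ffact.
  by rewrite leq_pmulr // fact_gt0.
(* The falling factorial is at least [n * (n - m) ^ (m - 1)]; Bernoulli's inequality then bounds
   [(1 - m / n) ^ (m - 1)] below. *)
have Cnm : n%:R * n%:R ^+ m.-1 * (1 - eps / 4) <= m`!%:R * 'C(n, m)%:R.
  apply: (@le_trans _ _ ((n - m)%:R ^+ m.-1 * n%:R)).
    rewrite natrB // (_ : n%:R - m%:R = n%:R * (1 - m%:R / n%:R)); last first.
      by field; rewrite gt_eqF.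
    rewrite exprMn [leRHS]mulrC [leRHS]mulrA; apply: ler_wpM2l.
      by rewrite mulr_ge0 ?exprn_ge0.
    apply: le_trans (bernoulli_ineq _ mn01); rewrite lerD2l lerN2.
    apply: le_trans mmn; rewrite -(mulr_natr (_ / _)) mulrAC -natrM.
    by apply: ler_wpM2r; rewrite ?invr_ge0 // ler_nat leq_mul2l leq_pred orbT.
  rewrite -natrX -!natrM ler_nat mulnC [leqRHS]mulnC bin_ffact.
  case: m m0 mlen {m1 mn mmn mn01 nx} => // m _ mn.
  case: n n0 mn {nR0 n1 CN} => // n _ mn; rewrite ffactSS leq_mul2l /= subSS.
  exact: expn_leq_ffact.
have m_gt0 : 0 < m`!%:R :> R by rewrite ltr0n fact_gt0.
have key : n%:R * (1 + eps / 2) * x <= 'C(n, m)%:R * L.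
  rewrite -(ler_pM2l m_gt0) [leRHS]mulrA.
  apply: le_trans (ler_wpM2r (ltW L0) Cnm).
  rewrite [leRHS](_ : _ = n%:R * (1 - eps / 4) * (n%:R ^+ m.-1 * L)); last by ring.
  apply: (@le_trans _ _ (n%:R * (1 - eps / 4) * (m`!%:R * (1 + eps) * x))).
    rewrite [leLHS](_ : _ = n%:R * m`!%:R * x * (1 + eps / 2)); last by ring.
    rewrite [leRHS](_ : _ = n%:R * m`!%:R * x * ((1 - eps / 4) * (1 + eps))); last by ring.
    by apply: ler_wpM2l; [rewrite !mulr_ge0|nra].
  by apply: ler_wpM2l nx; rewrite mulr_ge0 //; lra.
apply: (@le_trans _ _ (expR (n%:R * x) * expR (- ('C(n, m)%:R * L)))).
  rewrite expRN [expR ('C(n, m)%:R * L)]expRM_natl lnK ?posrE ?invr_gt0 //.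
  rewrite exprVn invrK; apply: ler_wpM2r CN.
  by rewrite exprn_ge0 // ltW.
rewrite -expRD ler_expR.
apply: (@le_trans _ _ (- (n%:R * (eps / 2 * x)))); first by lra.
rewrite lerN2 ler_peMl // mulr_ge0 //; lra.
Qed.

(** * Asymptotics on the two sides of the threshold *)

Lemma powerless_below_threshold (R : realType) (m : nat) (p0 eps : R)
    (n : nat -> nat) :
  (2 <= m)%N -> 0 < p0 -> p0 < 1 -> (forall N, (n N <= N)%N) ->
  0 < eps -> eps < 1 ->
  (\forall N \near \oo, (n N)%:R <= clique_threshold m p0 (1 - eps) N) ->
  all_tests_asymptotically_powerless m n p0 1.
Proof.
move=> m2 p_gt0 p_lt1 nN eps0 eps1 small T.
have m1 : (0 < m.-1)%N by rewrite -subn1 subn_gt0.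
have L0 : 0 < ln p0^-1 by rewrite ln_gt0 // invf_gt1.
have lower delta : 0 < delta ->
    \forall N \near \oo, 1 - delta <= risk (n N) p0 1 (T N).
  move=> delta0; pose C := m`!%:R * (1 - eps) / ln p0^-1.
  (* The second moment ratio will be at most an exponential; its exponent must not exceed
     [ln (1 + delta ^+ 2)] for [risk_ge] to apply. *)
  have eta0 : 0 < ln (1 + delta ^+ 2) by rewrite ln_gt0 // ltrDl exprn_gt0.
  near=> N.
  have x0 : 0 <= ln N%:R :> R by near: N; exact: near_ln_ge.
  have N0 : (0 < N)%N by near: N; exact: nbhs_infty_gt.
  have decay : (C * ln N%:R) ^+ 2 * expR (- (eps * ln N%:R)) <=
      ln (1 + delta ^+ 2) by near: N; exact: near_sqr_ln_decay.
  have nX : (n N)%:R ^+ m.-1 <= C * ln N%:R.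
    rewrite /C -mulrA (mulrC _^-1) -clique_threshold_expr ?subr_ge0 ?(ltW eps1) //.
    by rewrite ler_pXn2r ?nnegrE ?powR_ge0 //; near: N.
  pose x : R := ln N%:R; pose a := expR ((1 - eps) * x).
  have a1 : 1 <= a by rewrite -expR0 ler_expR mulr_ge0 // subr_ge0 ltW.
  apply: risk_ge => //; first exact: ltW.
  apply: le_trans (@clique_count_second_moment _ _ _ _ a _ p_gt0 (nN N) a1 _) _.
    move=> k kn; apply: (inv_expr_bin_le _ p_gt0 p_lt1 kn); first exact: ltnW.
    apply: le_trans (ler_wpM2r (ltW L0) nX) _.
    by rewrite le_eqVlt; apply/orP; left; apply/eqP; rewrite /C /x; field; rewrite gt_eqF.
  rewrite ler_wpM2l ?sqr_ge0 //.
  have aN : a / N%:R = expR (- (eps * x)).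
    rewrite /a mulrBl mul1r expRD /x lnK ?posrE ?ltr0n // mulrAC divff ?mul1r //.
    by rewrite pnatr_eq0 -lt0n.
  (* For a natural number, [n <= n ^ (m - 1)] because [m - 1] is positive. *)
  have nle : (n N)%:R <= C * x.
    apply: le_trans nX; rewrite -natrX ler_nat.
    by case: (n N) => // k; exact: (@leq_pexp2l k.+1 1).
  (* This uses [1 + z <= expR z], after bounding [a - 1] by [a]. *)
  apply: (@le_trans _ _ (expR (a / N%:R * (n N)%:R ^+ 2))).
    rewrite (_ : a / _ * _ = (n N)%:R * (a * ((n N)%:R / N%:R))); last by ring.
    rewrite expRM_natl; apply: lerXn2r; rewrite ?nnegrE ?expR_ge0 //.
      by rewrite addr_ge0 // mulr_ge0 ?divr_ge0 // subr_ge0.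
    apply: le_trans (expR_ge1Dx _); rewrite lerD2l ler_wpM2r ?divr_ge0 //.
    by rewrite gerBl.
  rewrite -[leRHS]lnK ?posrE ?addr_gt0 ?exprn_gt0 // ler_expR aN mulrC.
  apply: le_trans decay; rewrite ler_wpM2r ?expR_ge0 //.
  by rewrite lerXn2r ?nnegrE //; apply: le_trans nle.
split=> // upper; apply/cvgrPdist_le => e e0; near=> N.
have up : risk (n N) p0 1 (T N) <= 1 by near: N.
have low : 1 - e <= risk (n N) p0 1 (T N) by near: N; exact: lower.
by rewrite ger0_norm ?subr_ge0 // lerBlDr -lerBlDl.
Unshelve. all: by end_near. Qed.

Lemma HCNT_powerful_above_threshold (R : realType) (m : nat) (p0 eps : R)
    (n : nat -> nat) :
  (2 <= m)%N -> 0 < p0 -> p0 < 1 -> (forall N, (n N <= N)%N) ->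
  0 < eps -> eps < 1 ->
  (\forall N \near \oo, clique_threshold m p0 (1 + eps) N <= (n N)%:R) ->
  asymptotically_powerful n p0 1 (@HCNT m n).
Proof.
move=> m2 p_gt0 p_lt1 nN eps0 eps1 large.
have m1 : (0 < m.-1)%N by rewrite -subn1 subn_gt0.
have L0 : 0 < ln p0^-1 by rewrite ln_gt0 // invf_gt1.
have e10 : 0 <= 1 + eps by rewrite addr_ge0 // ltW.
apply/cvgr0Pnorm_le => e e_gt0.
(* [M <= n N] yields both [4 * m ^ 2 <= eps * n N] and, through the added 1, the positivity of
   [n N]. *)
pose M := (m * m)%:R * 4 / eps + 1.
have M0 : 0 < M by rewrite ltr_wpDl // divr_ge0 // ltW.
near=> N.
have x0 : 0 <= ln N%:R :> R by near: N; exact: near_ln_ge.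
have N0 : (0 < N)%N by near: N; exact: nbhs_infty_gt.
have nX : m`!%:R * (1 + eps) * (ln N%:R / ln p0^-1) <= (n N)%:R ^+ m.-1.
  rewrite -clique_threshold_expr //.
  by rewrite ler_pXn2r ?nnegrE ?powR_ge0 //; near: N.
(* The threshold grows with [ln N], so [n N] eventually exceeds any constant. *)
have Mn : M <= (n N)%:R.
  rewrite -(@ler_pXn2r _ m.-1) ?nnegrE ?(ltW M0) //.
  apply: le_trans nX; rewrite mulrA ler_pdivlMr //.
  rewrite -ler_pdivrMl ?mulr_gt0 ?ltr0n ?fact_gt0 ?(lt_le_trans ltr01) ?lerDl ?(ltW eps0) //.
  by near: N; exact: near_ln_ge.
have n0 : (0 < n N)%N by rewrite -(ltr0n R); exact: lt_le_trans Mn.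
have /andP[ge0 le] := @risk_HCNT_le R m N p0 n p_gt0 (ltW p_lt1) n0 (nN N).
rewrite ger0_norm //; apply: le_trans le _.
apply: (@le_trans _ _ (expR (- (eps / 2 * ln N%:R)))).
  apply: clique_mean_le => //; first exact: ltnW.
    rewrite -ler_pdivrMl // mulrC.
    by apply: le_trans Mn; rewrite lerDl.
  by rewrite -ler_pdivrMr // -[leLHS]mulrA.
rewrite -[leRHS]lnK ?posrE // ler_expR lerNl -ler_pdivrMl ?divr_gt0 //.
by near: N; exact: near_ln_ge.
Unshelve. all: by end_near. Qed.

Theorem theorem2p1 (R : realType) (m : nat) (hm : (2 <= m)%N)
    (p0 : R) (hp0 : 0 < p0) (hp0' : p0 < 1)
    (n : nat -> nat) (hn : forall N : nat, (n N <= N)%N) :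
  (forall eps : R, 0 < eps -> eps < 1 ->
     (\forall N \near \oo, (n N)%:R <= clique_threshold m p0 (1 - eps) N) ->
     all_tests_asymptotically_powerless m n p0 1) /\
  (forall eps : R, 0 < eps -> eps < 1 ->
     (\forall N \near \oo, clique_threshold m p0 (1 + eps) N <= (n N)%:R) ->
     asymptotically_powerful n p0 1 (@HCNT m n)).
Proof.
split=> eps eps0 eps1; first exact: powerless_below_threshold.
exact: HCNT_powerful_above_threshold.
Qed.
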